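(* Let $m,n\ge2$. Every diagonally dominated biquadratic tensor in $\mathbb{R}^{m\times n\times m\times n}$ is positive semi-definite, and every strictly diagonally dominated biquadratic tensor in $\mathbb{R}^{m\times n\times m\times n}$ is positive definite.
   Context: Write $[n]=\{1,\dots,n\}$. A biquadratic tensor is a real fourth-order tensor $\mathcal{A}=(a_{i_1j_1i_2j_2})\in\mathbb{R}^{m\times n\times m\times n}$, $i_1,i_2\in[m]$, $j_1,j_2\in[n]$, $m,n\ge2$ (no symmetry assumed). The entries $a_{ijij}$ are the diagonal entries, all others are off-diagonal. Set $\bar a_{i_1j_1i_2j_2}=a_{i_1j_1i_2j_2}$ for off-diagonal entries and $\bar a_{i_1j_1i_2j_2}=0$ for diagonal entries. $\mathcal{A}$ is diagonally dominated if for all $i\in[m]$, $j\in[n]$, $$a_{ijij}\ge \frac14\sum_{i_1=1}^m\Big(\sum_{j_2=1}^n|\bar a_{i_1jij_2}|+\sum_{j_1=1}^n|\bar a_{i_1j_1ij}|\Big)+\frac14\sum_{i_2=1}^m\Big(\sum_{j_2=1}^n|\bar a_{iji_2j_2}|+\sum_{j_1=1}^n|\bar a_{ij_1i_2j}|\Big),$$ and strictly diagonally dominated if all these $mn$ inequalities are strict. Put $f(\mathbf{x},\mathbf{y})=\sum_{i_1,i_2=1}^m\sum_{j_1,j_2=1}^n a_{i_1j_1i_2j_2}x_{i_1}y_{j_1}x_{i_2}y_{j_2}$. $\mathcal{A}$ is positive semi-definite if $f(\mathbf{x},\mathbf{y})\ge0$ for all $\mathbf{x}\in\mathbb{R}^m,\mathbf{y}\in\mathbb{R}^n$,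 and positive definite if $f(\mathbf{x},\mathbf{y})>0$ whenever $\mathbf{x}^\top\mathbf{x}=\mathbf{y}^\top\mathbf{y}=1$. *)

(* Defs.v *)
From HB Require Import structures.
From mathcomp Require Import all_boot all_order all_algebra.
From mathcomp Require Import reals.

Set Implicit Arguments.
Unset Strict Implicit.
Unset Printing Implicit Defensive.

Import Order.TTheory GRing.Theory Num.Theory.
Local Open Scope ring_scope.

(* Argument order: A i1 j1 i2 j2 stands for the entry a_{i1 j1 i2 j2}; indices
   are 0-based. *)
Definition biquadratic_tensor (R : realType) (m n : nat) : Type :=
  'I_m -> 'I_n -> 'I_m -> 'I_n -> R.

Definition off_diag (R : realType) (m n : nat) (A : biquadratic_tensor R m n) :
    biquadratic_tensor R m n :=
  fun i1 j1 i2 j2 => if (i1 == i2) && (j1 == j2) then 0 else A i1 j1 i2 j2.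

Definition dominance_bound (R : realType) (m n : nat)
    (A : biquadratic_tensor R m n) (i : 'I_m) (j : 'I_n) : R :=
  4%:R^-1 * (\sum_(i1 < m) (\sum_(j2 < n) `|off_diag A i1 j i j2|
                            + \sum_(j1 < n) `|off_diag A i1 j1 i j|))
  + 4%:R^-1 * (\sum_(i2 < m) (\sum_(j2 < n) `|off_diag A i j i2 j2|
                              + \sum_(j1 < n) `|off_diag A i j1 i2 j|)).

Definition diagonally_dominated (R : realType) (m n : nat)
    (A : biquadratic_tensor R m n) : Prop :=
  forall (i : 'I_m) (j : 'I_n), dominance_bound A i j <= A i j i j.

Definition strictly_diagonally_dominated (R : realType) (m n : nat)
    (A : biquadratic_tensor R m n) : Prop :=
  forall (i : 'I_m) (j : 'I_n), dominance_bound A i j < A i j i j.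

Definition biquadratic_form (R : realType) (m n : nat)
    (A : biquadratic_tensor R m n) (x : 'cV[R]_m) (y : 'cV[R]_n) : R :=
  \sum_(i1 < m) \sum_(i2 < m) \sum_(j1 < n) \sum_(j2 < n)
    A i1 j1 i2 j2 * x i1 0 * y j1 0 * x i2 0 * y j2 0.

Definition positive_semidefinite (R : realType) (m n : nat)
    (A : biquadratic_tensor R m n) : Prop :=
  forall (x : 'cV[R]_m) (y : 'cV[R]_n), 0 <= biquadratic_form A x y.

Definition positive_definite (R : realType) (m n : nat)
    (A : biquadratic_tensor R m n) : Prop :=
  forall (x : 'cV[R]_m) (y : 'cV[R]_n),
    x^T *m x = 1%:M -> y^T *m y = 1%:M -> 0 < biquadratic_form A x y.

(* Main.v *)
Require Import Defs.
From mathcomp Require Import all_boot all_order all_algebra.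
From mathcomp Require Import reals.
From mathcomp Require Import ring lra.

(** The product [x_i1 y_j1 x_i2 y_j2] can be split into two factors in two
    ways, [(x_i1 y_j1)(x_i2 y_j2)] and [(x_i1 y_j2)(x_i2 y_j1)].  Averaging the
    two resulting inequalities [2 |p q| <= p^2 + q^2] bounds its absolute value
    by a quarter of the sum of the four squares [x_i^2 y_j^2] with [i] in
    [{i1, i2}] and [j] in [{j1, j2}] (lemma [normr_mul4_le]).  Multiplying by
    the moduli of the off-diagonal entries and summing, the coefficient of
    [x_i^2 y_j^2] collects a quarter of the modulus of [a_i1j1i2j2] for each of
    the four ways of matching [i] with [i1] or [i2] and [j] with [j1] or [j2];
    this is exactly [dominance_bound A i j] (lemma [sum_dominance_boundE]).  Hence
      [f(x, y) >= sum_(i, j) (a_ijij - dominance_bound A i j) x_i^2 y_j^2],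
    which is lemma [biquadratic_form_ge].  Dominance makes every term of the
    right-hand side nonnegative; strict dominance makes one of them positive as
    soon as [x] and [y] are both nonzero. *)

Set Implicit Arguments.
Unset Strict Implicit.
Unset Printing Implicit Defensive.

Import Order.TTheory GRing.Theory Num.Theory.
Local Open Scope ring_scope.

Lemma normr_mul4_le (R : realFieldType) (a b c d : R) :
  `|a * b * c * d| <= 4%:R^-1 * (a ^+ 2 * b ^+ 2 + a ^+ 2 * d ^+ 2
                                 + c ^+ 2 * b ^+ 2 + c ^+ 2 * d ^+ 2).
Proof.
rewrite ler_norml; apply/andP; split.
- have h1 := sqr_ge0 (a * b + c * d); have h2 := sqr_ge0 (a * d + c * b).
  by nra.
- have h1 := sqr_ge0 (a * b - c * d); have h2 := sqr_ge0 (a * d - c * b).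
  by nra.
Qed.

Lemma sum_dominance_boundE (R : realType) (m n : nat)
    (A : biquadratic_tensor R m n) (w : 'I_m -> 'I_n -> R) :
  \sum_(i < m) \sum_(j < n) dominance_bound A i j * w i j =
  \sum_(i1 < m) \sum_(i2 < m) \sum_(j1 < n) \sum_(j2 < n)
    `|off_diag A i1 j1 i2 j2|
    * (4%:R^-1 * (w i1 j1 + w i1 j2 + w i2 j1 + w i2 j2)).
Proof.
pose B i1 j1 i2 j2 := 4%:R^-1 * `|off_diag A i1 j1 i2 j2|.
have -> : \sum_(i < m) \sum_(j < n) dominance_bound A i j * w i j =
  \sum_i \sum_j (\sum_i1 \sum_j2 B i1 j i j2 * w i j) +
  \sum_i \sum_j (\sum_i1 \sum_j1 B i1 j1 i j * w i j) +
  \sum_i \sum_j (\sum_i2 \sum_j2 B i j i2 j2 * w i j) +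
  \sum_i \sum_j (\sum_i2 \sum_j1 B i j1 i2 j * w i j).
  rewrite -!big_split; apply: eq_bigr => i _ /=.
  rewrite -!big_split; apply: eq_bigr => j _ /=.
  rewrite /dominance_bound !big_split /= !mulrDr !mulrDl !addrA.
  by congr (_ + _ + _ + _); rewrite mulr_sumr mulr_suml; apply: eq_bigr => k _;
    rewrite mulr_sumr mulr_suml.
have E1 : \sum_i \sum_j (\sum_i1 \sum_j2 B i1 j i j2 * w i j) =
    \sum_i1 \sum_i2 \sum_j1 \sum_j2 B i1 j1 i2 j2 * w i2 j1.
  rewrite [RHS]exchange_big; apply: eq_bigr => i _ /=.
  by rewrite exchange_big.
have E2 : \sum_i \sum_j (\sum_i1 \sum_j1 B i1 j1 i j * w i j) =
    \sum_i1 \sum_i2 \sum_j1 \sum_j2 B i1 j1 i2 j2 * w i2 j2.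
  rewrite [RHS]exchange_big; apply: eq_bigr => i _ /=.
  by rewrite exchange_big; apply: eq_bigr => k _ /=; rewrite exchange_big.
have E3 : \sum_i \sum_j (\sum_i2 \sum_j2 B i j i2 j2 * w i j) =
    \sum_i1 \sum_i2 \sum_j1 \sum_j2 B i1 j1 i2 j2 * w i1 j1.
  by apply: eq_bigr => i _; rewrite exchange_big.
have E4 : \sum_i \sum_j (\sum_i2 \sum_j1 B i j1 i2 j * w i j) =
    \sum_i1 \sum_i2 \sum_j1 \sum_j2 B i1 j1 i2 j2 * w i1 j2.
  apply: eq_bigr => i _; rewrite exchange_big; apply: eq_bigr => k _ /=.
  by rewrite exchange_big.
rewrite E1 E2 E3 E4 -!big_split; apply: eq_bigr => i1 _ /=.
rewrite -!big_split; apply: eq_bigr => i2 _ /=.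
rewrite -!big_split; apply: eq_bigr => j1 _ /=.
rewrite -!big_split; apply: eq_bigr => j2 _ /=.
by rewrite /B; ring.
Qed.

Lemma biquadratic_form_diagE (R : realType) (m n : nat)
    (A : biquadratic_tensor R m n) (x : 'cV[R]_m) (y : 'cV[R]_n) :
  biquadratic_form A x y =
  \sum_(i < m) \sum_(j < n) A i j i j * (x i 0 ^+ 2 * y j 0 ^+ 2)
  + biquadratic_form (off_diag A) x y.
Proof.
rewrite /biquadratic_form -big_split; apply: eq_bigr => i _ /=.
rewrite (bigD1 i) //= [in RHS](bigD1 i) //= addrA; congr (_ + _).
  rewrite -big_split; apply: eq_bigr => j _ /=.
  rewrite (bigD1 j) //= [in RHS](bigD1 j) //= addrA; congr (_ + _).
    by rewrite /off_diag !eqxx /=; ring.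
  by apply: eq_bigr => k; rewrite /off_diag eqxx eq_sym /= => /negbTE ->.
apply: eq_bigr => k; rewrite eq_sym => /negbTE nki.
by apply: eq_bigr => j _; apply: eq_bigr => l _; rewrite /off_diag nki.
Qed.

Lemma biquadratic_form_ge (R : realType) (m n : nat)
    (A : biquadratic_tensor R m n) (x : 'cV[R]_m) (y : 'cV[R]_n) :
  \sum_(i < m) \sum_(j < n)
    (A i j i j - dominance_bound A i j) * (x i 0 ^+ 2 * y j 0 ^+ 2)
  <= biquadratic_form A x y.
Proof.
have -> : \sum_(i < m) \sum_(j < n)
    (A i j i j - dominance_bound A i j) * (x i 0 ^+ 2 * y j 0 ^+ 2) =
  \sum_(i < m) \sum_(j < n) A i j i j * (x i 0 ^+ 2 * y j 0 ^+ 2) -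
  \sum_(i < m) \sum_(j < n)
    dominance_bound A i j * (x i 0 ^+ 2 * y j 0 ^+ 2).
  rewrite -sumrB; apply: eq_bigr => i _; rewrite -sumrB.
  by apply: eq_bigr => j _; rewrite mulrBl.
rewrite biquadratic_form_diagE lerD2l.
rewrite (sum_dominance_boundE A (fun i j => x i 0 ^+ 2 * y j 0 ^+ 2)) lerNl.
rewrite /biquadratic_form -sumrN; apply: ler_sum => i1 _.
rewrite -sumrN; apply: ler_sum => i2 _.
rewrite -sumrN; apply: ler_sum => j1 _.
rewrite -sumrN; apply: ler_sum => j2 _.
apply: le_trans (ler_norm _) _; rewrite normrN.
set a := off_diag A _ _ _ _; have -> (b c d e : R) :
  a * b * c * d * e = a * (b * c * d * e) by rewrite !mulrA.
by rewrite normrM; apply: ler_wpM2l => //; apply: normr_mul4_le.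
Qed.

Lemma unit_col_neq0 (R : realType) (k : nat) (x : 'cV[R]_k) :
  x^T *m x = 1%:M -> exists i, x i 0 != 0.
Proof.
move=> xx1; apply/existsP.
have [//|/existsPn x0] := boolP [exists i, x i 0 != 0].
have := congr1 (fun M : 'M_1 => M 0 0) xx1.
rewrite !mxE big1 => [/eqP|i _]; first by rewrite eqxx eq_sym oner_eq0.
by have /negPn/eqP xi0 := x0 i; rewrite xi0 mulr0.
Qed.

Theorem corollary4p2 (R : realType) (m n : nat) (hm : (2 <= m)%N) (hn : (2 <= n)%N) :
  (forall A : biquadratic_tensor R m n,
     diagonally_dominated A -> positive_semidefinite A) /\
  (forall A : biquadratic_tensor R m n,
     strictly_diagonally_dominated A -> positive_definite A).
Proof.
have sq2_ge0 (x : 'cV[R]_m) (y : 'cV[R]_n) i j :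
  0 <= x i 0 ^+ 2 * y j 0 ^+ 2 by rewrite mulr_ge0 ?sqr_ge0.
split=> A domA x y => [|/unit_col_neq0[i xi0] /unit_col_neq0[j yj0]].
  apply: le_trans (biquadratic_form_ge A x y).
  apply: sumr_ge0 => i _; apply: sumr_ge0 => j _.
  by rewrite mulr_ge0 // subr_ge0 domA.
apply: lt_le_trans (biquadratic_form_ge A x y).
have term_ge0 k l :
    0 <= (A k l k l - dominance_bound A k l) * (x k 0 ^+ 2 * y l 0 ^+ 2).
  by rewrite mulr_ge0 // subr_ge0 ltW ?domA.
rewrite (bigD1 i) //= ltr_wpDr //.
  by apply: sumr_ge0 => k _; apply: sumr_ge0.
rewrite (bigD1 j) //= ltr_wpDr //; first exact: sumr_ge0.
by rewrite mulr_gt0 ?subr_gt0 ?domA // mulr_gt0 // exprn_even_gt0.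
Qed.
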